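(* There exist relational schemas $\mathcal{D},\mathcal{Q}$ and a first-order rewritable OCQA ontology $O$ over $(\mathcal{D},\mathcal{Q})$ that cannot be defined by any finite set of disjunctive tuple-generating dependencies (DTGDs); that is, there are no relational schema $\mathcal{R}\supseteq\mathcal{D}\cup\mathcal{Q}$ and finite set $\Sigma$ of DTGDs over $\mathcal{R}$ with $O=Sem(\Sigma,\mathcal{D},\mathcal{Q})$.
   Context: Databases. Fix infinite disjoint sets of constants and variables; terms are constants or variables. A relational schema is a set of relation symbols with arities (arity $0$ allowed). A fact is a variable-free relation atom; an instance over $\mathcal{R}$ is a (possibly infinite) set of facts over $\mathcal{R}$; a database is a finite instance. $adom(I)$ is the set of constants occurring in $I$. An instance is regarded as a structure with domain $adom(I)$, constants denoting themselves. For databases $D,D'$ and $C\subseteq adom(D)\cap adom(D')$, write $D\Rightarrow_C D'$ if there is an injective $h:adom(D)\to adom(D')$ with $h(c)=c$ for all $c\in C$ and such that $R(\vec a)\in D$ implies $R(h(\vec a))\in D'$ for every relation symbol $R$. Queries. A boolean conjunctive query (BCQ) over $\mathcal{Q}$ is a sentence $\exists\vec y\,\varphi(\vec y)$ with $\varphi$ a nonempty conjunction of relation atoms over $\mathcal{Q}$ (constants allowed). $const(q)$ is the set of constants occurring in $q$. Dependencies. A disjunctive tuple-generating dependency (DTGD) over $\mathcal{R}$ is a first-order sentence $\forall\vec x\forall\vec y\,(\phi(\vec x,\vec y)\to\exists\vec z_1.\psi_1(\vec x,\vec z_1)\vee\cdots\vee\exists\vec z_k.\psi_k(\vec x,\vec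 z_k))$ with $k\ge1$, where $\phi$ is a (possibly empty) conjunction of relation atoms over $\mathcal{R}$ with terms among the variables $\vec x,\vec y$, each $\psi_i$ is a conjunction of relation atoms over $\mathcal{R}$ (no equalities) with terms among the variables $\vec x,\vec z_i$, and every variable of $\vec x$ occurs in $\phi$. For a database $D$, a set $\Sigma$ of such sentences and a BCQ $q$ over $\mathcal{R}$, write $D\cup\Sigma\models q$ if every instance $I$ over $\mathcal{R}$ with $D\subseteq I$ and $I\models\Sigma$ satisfies $q$. $Sem(\Sigma,\mathcal{D},\mathcal{Q})$ is the set of pairs $(D,q)$ with $D$ a database over $\mathcal{D}$, $q$ a BCQ over $\mathcal{Q}$ with $const(q)\subseteq adom(D)$, and $D\cup\Sigma\models q$. Ontologies. An OCQA ontology over $(\mathcal{D},\mathcal{Q})$ is a set $O$ of pairs $(D,q)$, with $D$ a database over $\mathcal{D}$ and $q$ a BCQ over $\mathcal{Q}$ such that $const(q)\subseteq adom(D)$, satisfying: (1) $(D,q),(D,q')\in O$ implies $(D,q\wedge q')\in O$; (2) $q\models q'$ and $(D,q)\in O$ imply $(D,q')\in O$; (3) $D\Rightarrow_C D'$ and $(D,q)\in O$, where $C=const(q)$, imply $(D',q)\in O$. $O$ is first-order rewritable if for every BCQ $q$ over $\mathcal{Q}$ there is a first-order sentence $q_O$ such that for all databases $D$ over $\mathcal{D}$ with $const(q)\subseteq adom(D)$: $(D,q)\in O$ iff $D\models q_O$. *)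

(* Defs.v *)
(* MathComp, with the classical sets of MathComp-Analysis. *)
From mathcomp Require Import all_boot.
From mathcomp Require Import boolp classical_sets functions cardinality.

Set Implicit Arguments.
Unset Strict Implicit.
Unset Printing Implicit Defensive.

Local Open Scope classical_set_scope.

(* A relation symbol is a name together with an arity, so that there are
   infinitely many symbols of every arity, including 0. *)
Definition relsym : Type := (nat * nat)%type.
Definition arity (r : relsym) : nat := r.2.

Definition atom (X : Type) : Type := {r : relsym & (arity r).-tuple X}.

Definition arel {X : Type} (a : atom X) : relsym := tag a.
Definition aargs {X : Type} (a : atom X) : seq X := tagged a.

Definition map_atom {X Y : Type} (f : X -> Y) (a : atom X) : atom Y :=
  Tagged (fun r => (arity r).-tuple Y) [tuple of map f (tagged a)].

Section Syntax.
Variables const var : choiceType.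

Definition term : Type := (const + var)%type.

Definition fact : Type := atom const.
Definition instance : Type := set fact.

Definition over (R : set relsym) (I : instance) : Prop :=
  forall a, I a -> R (arel a).

Definition is_database (D : set relsym) (I : instance) : Prop :=
  finite_set I /\ over D I.

Definition adom (I : instance) : set const :=
  [set c | exists a, I a /\ c \in aargs a].

(* [I] embeds into [J] by an injection fixing [C] pointwise. *)
Definition db_arrow (C : set const) (I J : instance) : Prop :=
  C `<=` adom I `&` adom J /\
  exists h : const -> const,
    [/\ set_fun (adom I) (adom J) h, set_inj (adom I) h,
        (forall c, C c -> h c = c) &
        (forall a, I a -> J (map_atom h a))].

Inductive fo : Type :=
  | FTrue
  | FAtom of atom term
  | FEq of term & term
  | FNot of fo
  | FAnd of fo & fo
  | FOr of fo & fo
  | FImp of fo & fo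
  | FAll of var & fo
  | FEx of var & fo.

Definition term_vars (s : seq term) : seq var :=
  pmap (fun t => if t is inr v then Some v else None) s.

Fixpoint free_vars (f : fo) : seq var :=
  match f with
  | FTrue => [::]
  | FAtom a => term_vars (aargs a)
  | FEq t u => term_vars [:: t; u]
  | FNot g => free_vars g
  | FAnd g h | FOr g h | FImp g h => free_vars g ++ free_vars h
  | FAll v g | FEx v g => [seq w <- free_vars g | w != v]
  end.

Definition is_sentence (f : fo) : Prop := free_vars f = [::].

Fixpoint fo_over (R : set relsym) (f : fo) : Prop :=
  match f with
  | FTrue | FEq _ _ => True
  | FAtom a => R (arel a)
  | FNot g | FAll _ g | FEx _ g => fo_over R g
  | FAnd g h | FOr g h | FImp g h => fo_over R g /\ fo_over R h
  end.

Definition term_val (nu : var -> const) (t : term) : const :=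
  match t with inl c => c | inr v => nu v end.

(* Quantifiers range over the active domain, which may be empty. *)
Fixpoint sat (I : instance) (nu : var -> const) (f : fo) : Prop :=
  match f with
  | FTrue => True
  | FAtom a => I (map_atom (term_val nu) a)
  | FEq t u => term_val nu t = term_val nu u
  | FNot g => ~ sat I nu g
  | FAnd g h => sat I nu g /\ sat I nu h
  | FOr g h => sat I nu g \/ sat I nu h
  | FImp g h => sat I nu g -> sat I nu h
  | FAll v g => forall c, adom I c -> sat I [eta nu with v |-> c] g
  | FEx v g => exists c, adom I c /\ sat I [eta nu with v |-> c] g
  end.

(* Used for sentences only, whose truth does not depend on [nu]. *)
Definition models (I : instance) (f : fo) : Prop := forall nu, sat I nu f.

Definition conj_atoms (s : seq (atom term)) : fo :=
  foldr FAnd FTrue (map FAtom s).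

(* A query is given by its list of atoms; all the variables occurring in it
   are existentially quantified. *)
Definition bcq : Type := seq (atom term).

Definition bcq_vars (q : bcq) : seq var :=
  undup (flatten [seq term_vars (aargs a) | a <- q]).

Definition bcq_fo (q : bcq) : fo := foldr FEx (conj_atoms q) (bcq_vars q).

Definition is_bcq (Q : set relsym) (q : bcq) : Prop :=
  q != [::] /\ forall a, a \in q -> Q (arel a).

Definition bcq_const (q : bcq) : set const :=
  [set c | exists2 a, a \in q & inl c \in aargs a].

Definition bcq_entails (q q' : bcq) : Prop :=
  forall I, models I (bcq_fo q) -> models I (bcq_fo q').

Definition rename_term (f : var -> var) (t : term) : term :=
  match t with inl c => inl c | inr v => inr (f v) end.

(* [r] is the conjunction of the sentences [q] and [q'] put in prenex form:
   the variables of [q'] are first renamed apart from those of [q]. *)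
Definition bcq_conj (q q' r : bcq) : Prop :=
  exists f : var -> var,
    [/\ injective f,
        (forall v, v \in bcq_vars q' -> f v \notin bcq_vars q) &
        r = q ++ map (map_atom (rename_term f)) q'].

(* The sentence forall xs ys, body -> \/_((zs, psi) <- heads) exists zs, psi.
   The lists ys and zs may contain variables that do not occur in the atoms;
   this matters only for instances with an empty active domain. *)
Record dtgd : Type := Dtgd {
  dtgd_xs : seq var;
  dtgd_ys : seq var;
  dtgd_body : seq (atom var);
  dtgd_heads : seq (seq var * seq (atom var))
}.

Definition is_dtgd (R : set relsym) (d : dtgd) : Prop :=
  [/\ (forall a, a \in dtgd_body d ->
         R (arel a) /\ {subset aargs a <= dtgd_xs d ++ dtgd_ys d}),
      (forall x, x \in dtgd_xs d -> exists2 a, a \in dtgd_body d & x \in aargs a),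
      dtgd_heads d != [::] &
      (forall p, p \in dtgd_heads d -> forall a, a \in p.2 ->
         R (arel a) /\ {subset aargs a <= dtgd_xs d ++ p.1})].

Definition var_term (v : var) : term := inr v.

Definition conj_var_atoms (s : seq (atom var)) : fo :=
  conj_atoms (map (map_atom var_term) s).

Definition dtgd_fo (d : dtgd) : fo :=
  foldr FAll
    (FImp (conj_var_atoms (dtgd_body d))
          (foldr FOr (FNot FTrue)
             [seq foldr FEx (conj_var_atoms p.2) p.1 | p <- dtgd_heads d]))
    (dtgd_xs d ++ dtgd_ys d).

(* D \cup Sigma |= q, relative to instances over R *)
Definition entails (R : set relsym) (D : instance) (Sigma : set dtgd)
    (q : bcq) : Prop :=
  forall I, over R I -> D `<=` I ->
    (forall d, Sigma d -> models I (dtgd_fo d)) -> models I (bcq_fo q).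

Definition is_pair (D Q : set relsym) (p : instance * bcq) : Prop :=
  [/\ is_database D p.1, is_bcq Q p.2 & bcq_const p.2 `<=` adom p.1].

Definition Sem (R : set relsym) (Sigma : set dtgd) (D Q : set relsym) :
    set (instance * bcq) :=
  [set p | is_pair D Q p /\ entails R p.1 Sigma p.2].

Record is_ontology (D Q : set relsym) (O : set (instance * bcq)) : Prop :=
  IsOntology {
    ontology_pair : O `<=` is_pair D Q;
    ontology_conj : forall I q q' r,
      O (I, q) -> O (I, q') -> bcq_conj q q' r -> O (I, r);
    ontology_entails : forall I q q',
      is_bcq Q q' -> bcq_entails q q' -> O (I, q) -> O (I, q');
    ontology_arrow : forall I J q,
      is_database D J -> db_arrow (bcq_const q) I J -> O (I, q) -> O (J, q)
  }.

Definition fo_rewritable (D Q : set relsym) (O : set (instance * bcq)) : Prop :=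
  forall q, is_bcq Q q ->
    exists qO : fo, [/\ is_sentence qO, fo_over D qO &
      forall I, is_database D I -> bcq_const q `<=` adom I ->
        (O (I, q) <-> models I qO)].

End Syntax.

(* Main.v *)
(* Over the empty data schema the only database is empty, so an ontology is
   just a deductively closed set of boolean conjunctive queries, and rewriting a
   query amounts to choosing true or false.  The queries saying that there is a
   path of length n from a start node to an end node are independent of each
   other, so there are uncountably many such ontologies.  On the other hand,
   finite sets of DTGDs are countable up to renaming of variables, and only
   finitely many relation symbols of the schema R influence their consequences.
   A diagonal argument thus yields an ontology that no finite set of DTGDs
   defines. *)
Require Import Defs.
From HB Require Import structures.
From mathcomp Require Import all_boot.
From mathcomp Require Import boolp classical_sets cardinality.

Set Implicit Arguments.
Unset Strict Implicit.
Unset Printing Implicit Defensive.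

Local Open Scope classical_set_scope.

(** * Infinite types and maps on atoms *)

Lemma infinite_inhabited (T : Type) : infinite_set [set: T] -> inhabited T.
Proof.
move=> infT; apply: contrapT => noT; apply: infT.
suff -> : [set: T] = set0 by exact: finite_set0.
by apply/seteqP; split => // x _; apply: noT; exists.
Qed.

Lemma infinite_injection (T : choiceType) :
  infinite_set [set: T] -> exists x : nat -> T, injective x.
Proof.
move=> infT; have [c0] := infinite_inhabited infT.
pose U : pointedType :=
    HB.pack (Choice.sort T) (Choice.class T) (isPointed.Build T c0).
have /infiniteP leT : infinite_set [set: U] := infT.
have [x xinj] := pcard_injP leT.
by exists x => m n; apply: xinj; rewrite inE.
Qed.

Lemma infinite_other (T : Type) (c : T) :
  infinite_set [set: T] -> exists d, d <> c.
Proof.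
move=> infT; apply: contrapT => no; apply: infT.
suff -> : [set: T] = [set c] by exact: finite_set1.
apply/seteqP; split => // x _ /=; apply: contrapT => xc.
by apply: no; exists x.
Qed.

Lemma eq_map_atom (X : eqType) (Y : Type) (f g : X -> Y) (a : atom X) :
  {in aargs a, f =1 g} -> map_atom f a = map_atom g a.
Proof.
case: a => r t /= fg; congr existT; apply: val_inj => /=.
exact/eq_in_map.
Qed.

Lemma map_atom_comp (X Y Z : Type) (f : X -> Y) (g : Y -> Z) (a : atom X) :
  map_atom g (map_atom f a) = map_atom (g \o f) a.
Proof.
by case: a => r t; congr existT; apply: val_inj; rewrite /= map_comp.
Qed.

Lemma aargs_map (X Y : Type) (f : X -> Y) (a : atom X) :
  aargs (map_atom f a) = map f (aargs a).
Proof. by []. Qed.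

Lemma over_set0 (const : choiceType) (I : instance const) :
  Defs.over set0 I -> I = set0.
Proof. by move=> I0; apply/seteqP; split => // a /I0. Qed.

(** * Truth of formulas and conjunctive queries *)

Section Formulas.
Variables const var : choiceType.
Implicit Types (I J : instance const) (f : fo const var) (q : bcq const var).

Lemma mem_term_vars (s : seq (term const var)) v :
  (v \in term_vars s) = (inr v \in s).
Proof. by elim: s => [//|[c|w] s IHs] /=; rewrite !inE -IHs. Qed.

Lemma mem_bcq_vars q a v : a \in q -> inr v \in aargs a -> v \in bcq_vars q.
Proof.
move=> aq va; rewrite mem_undup; apply/flattenP.
by exists (term_vars (aargs a)); [exact: map_f | rewrite mem_term_vars].
Qed.

(** Bound variables are included, since a relabelling renames the binders too. *)
Fixpoint fo_vars f : seq var :=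
  match f with
  | FTrue => [::]
  | FAtom a => term_vars (aargs a)
  | FEq t u => term_vars [:: t; u]
  | FNot g => fo_vars g
  | FAnd g h | FOr g h | FImp g h => fo_vars g ++ fo_vars h
  | FAll v g | FEx v g => v :: fo_vars g
  end.

Fixpoint fo_rels f : seq relsym :=
  match f with
  | FTrue | FEq _ _ => [::]
  | FAtom a => [:: arel a]
  | FNot g | FAll _ g | FEx _ g => fo_rels g
  | FAnd g h | FOr g h | FImp g h => fo_rels g ++ fo_rels h
  end.

Lemma fo_over_rels (R : set relsym) f :
  fo_over R f <-> {in fo_rels f, forall r, R r}.
Proof.
elim: f => //= [a|g IHg h IHh|g IHg h IHh|g IHg h IHh].
  by split=> [Ra r|]; [rewrite inE => /eqP -> | apply; rewrite inE].
all: rewrite IHg IHh; split=> [[Rg Rh] r|R_].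
all: try by rewrite mem_cat => /orP[/Rg|/Rh].
all: by split=> r rgh; apply: R_; rewrite mem_cat rgh ?orbT.
Qed.

(** Quantifiers range over the active domain, so agreement on the symbols of the formula is not
    enough: the active domains must coincide. *)
Lemma sat_local I J f nu :
    adom I = adom J ->
    (forall a, arel a \in fo_rels f -> I a <-> J a) ->
  sat I nu f <-> sat J nu f.
Proof.
move=> IJ; elim: f nu => //= [a|g IHg|g IHg h IHh|g IHg h IHh|g IHg h IHh
  |v g IHg|v g IHg] nu ag.
- by apply: ag; rewrite inE.
- by rewrite IHg.
- by rewrite IHg ?IHh // => a ra; apply: ag; rewrite mem_cat ra ?orbT.
- by rewrite IHg ?IHh // => a ra; apply: ag; rewrite mem_cat ra ?orbT.
- by rewrite IHg ?IHh // => a ra; apply: ag; rewrite mem_cat ra ?orbT.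
- by rewrite IJ; split=> g_ c Jc; apply/IHg/g_.
- by rewrite IJ; split=> -[c [Jc gc]]; exists c; split => //; apply/IHg.
Qed.

Lemma models_local I J f :
    adom I = adom J ->
    (forall a, arel a \in fo_rels f -> I a <-> J a) ->
  models I f <-> models J f.
Proof. by move=> IJ rIJ; split=> fI nu; apply/(sat_local nu IJ rIJ). Qed.

Lemma sat_foldr_FEx I nu vs f :
  sat I nu (foldr (@FEx _ _) f vs) <->
  exists mu, [/\ {in predC (mem vs), mu =1 nu},
                 {in vs, forall v, adom I (mu v)} & sat I mu f].
Proof.
elim: vs nu => [|w vs IHvs] nu /=.
  split=> [fnu|[mu [munu _]]]; first by exists nu.
  by rewrite (_ : mu = nu) //; apply/funext => v; apply: munu.
split=> [[c [Ic /IHvs[mu [munu Imu fmu]]]]|[mu [munu Imu fmu]]].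
- exists mu; split=> // v.
    rewrite !inE negb_or => /andP[vw vvs].
    by rewrite munu ?inE //= (negbTE vw).
  rewrite inE; case: (boolP (v \in vs)) => [/Imu //|vvs].
  by rewrite orbF => /eqP vw; rewrite munu //= vw eqxx -?vw.
- exists (mu w); split; first by apply: Imu; rewrite inE eqxx.
  apply/IHvs; exists mu; split=> // v vvs /=.
    by case: eqP => [->//|/eqP vw]; apply: munu; rewrite !inE negb_or vw.
  by apply: Imu; rewrite inE vvs orbT.
Qed.

Lemma sat_conj_atoms I nu (s : seq (atom (term const var))) :
  sat I nu (conj_atoms s) <->
  {in s, forall a, I (map_atom (term_val nu) a)}.
Proof.
elim: s => [|b s IHs] //=; rewrite IHs; split=> [[Ib Is] a|Is].
  by rewrite inE => /predU1P[->|/Is].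
by split=> [|a sa]; apply: Is; rewrite inE ?eqxx ?sa ?orbT.
Qed.

(** Every quantified variable occurs in an atom, so its value lies in the active domain as soon as
    the atoms hold. The constant [c0] guarantees that there is an assignment at all. *)
Lemma models_bcqP I q (c0 : const) :
  models I (bcq_fo q) <->
  exists mu, {in q, forall a, I (map_atom (term_val mu) a)}.
Proof.
split=> [/(_ (fun=> c0))/sat_foldr_FEx[mu [_ _ /sat_conj_atoms]]|[mu qmu] nu].
  by exists mu.
(* Outside the query variables the assignment must agree with the given [nu]. *)
pose mu' v := if v \in bcq_vars q then mu v else nu v.
have qmu' : {in q, forall a, I (map_atom (term_val mu') a)}.
  move=> a aq; rewrite (@eq_map_atom _ _ _ (term_val mu)); first exact: qmu.
  by move=> [//|v] va; rewrite /= /mu' (mem_bcq_vars aq va).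
apply/sat_foldr_FEx; exists mu'; split; last exact/sat_conj_atoms.
  by move=> v; rewrite inE /= /mu' => /negbTE ->.
move=> v; rewrite mem_undup => /flattenP[_ /mapP[a aq ->]].
rewrite mem_term_vars => va; exists (map_atom (term_val mu') a).
by split; [exact: qmu' | rewrite aargs_map; apply/mapP; exists (inr v)].
Qed.

Lemma fo_rels_conj_atoms (s : seq (atom (term const var))) :
  fo_rels (conj_atoms s) = map arel s.
Proof. by elim: s => //= a s ->. Qed.

Lemma fo_rels_foldr_FEx vs f : fo_rels (foldr (@FEx _ _) f vs) = fo_rels f.
Proof. by elim: vs. Qed.

Lemma fo_rels_foldr_FAll vs f : fo_rels (foldr (@FAll _ _) f vs) = fo_rels f.
Proof. by elim: vs. Qed.

Lemma fo_rels_bcq q : fo_rels (bcq_fo q) = map arel q.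
Proof. by rewrite fo_rels_foldr_FEx fo_rels_conj_atoms. Qed.

Lemma fo_over_dtgd (R : set relsym) (d : dtgd var) :
  is_dtgd R d -> fo_over R (dtgd_fo const d).
Proof.
case=> bodyR _ _ headR; apply/fo_over_rels.
have relsE (s : seq (atom var)) r :
    r \in fo_rels (conj_var_atoms const s) -> exists2 a, a \in s & r = arel a.
  by rewrite fo_rels_conj_atoms -map_comp => /mapP.
rewrite fo_rels_foldr_FAll /= => r; rewrite mem_cat.
case/orP=> [/relsE[a ab ->]|]; first by case: (bodyR a ab).
elim: (dtgd_heads d) headR => [//|p ps IHps] headR /=; rewrite mem_cat.
case/orP=> [|rps]; last first.
  by apply: IHps rps => p' p'ps; apply: headR; rewrite inE p'ps orbT.
rewrite fo_rels_foldr_FEx => /relsE[a ap ->].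
by case: (headR p _ a ap); rewrite ?inE ?eqxx.
Qed.

End Formulas.

(** * Renaming variables into another type *)

Section Relabel.
Variables (const V W : choiceType) (f : V -> W).

Definition relabel_term (t : term const V) : term const W :=
  match t with inl c => inl c | inr v => inr (f v) end.

Fixpoint relabel_fo (F : fo const V) : fo const W :=
  match F with
  | FTrue => @FTrue _ _
  | FAtom a => FAtom (map_atom relabel_term a)
  | FEq t u => FEq (relabel_term t) (relabel_term u)
  | FNot G => FNot (relabel_fo G)
  | FAnd G H => FAnd (relabel_fo G) (relabel_fo H)
  | FOr G H => FOr (relabel_fo G) (relabel_fo H)
  | FImp G H => FImp (relabel_fo G) (relabel_fo H)
  | FAll v G => FAll (f v) (relabel_fo G)
  | FEx v G => FEx (f v) (relabel_fo G)
  end.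

Lemma sat_relabel (I : instance const) (s : seq V) (F : fo const V) nu mu :
    {subset fo_vars F <= s} -> {in s &, injective f} ->
    {in s, nu \o f =1 mu} ->
  sat I nu (relabel_fo F) <-> sat I mu F.
Proof.
move=> + finj; have valE t nu' mu' : {in s, nu' \o f =1 mu'} ->
    {subset term_vars [:: t] <= s} ->
    term_val nu' (relabel_term t) = term_val mu' t.
  by case: t => [//|v] /(_ v) /= numu vs; apply/numu/vs; rewrite inE.
(* Injectivity on [s] prevents capture: updating [f v] changes the value of no other variable of
   [s]. *)
have updE (nu' : W -> const) mu' v c : v \in s -> {in s, nu' \o f =1 mu'} ->
    {in s, [eta nu' with f v |-> c] \o f =1 [eta mu' with v |-> c]}.
  move=> vs numu w ws /=; case: eqP => [/finj->//|]; first by rewrite eqxx.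
  by case: eqP => [->//|_ _]; exact: numu.
elim: F nu mu => //= [a|t u|G IHG|G IHG H IHH|G IHG H IHH|G IHG H IHH
  |v G IHG|v G IHG] nu mu ss numu.
- rewrite map_atom_comp (@eq_map_atom _ _ _ (term_val mu)) // => t ta.
  apply: valE => // v; rewrite !mem_term_vars inE => /eqP vt.
  by apply: ss; rewrite mem_term_vars vt.
- have {}ss : {subset term_vars [:: t; u] <= s} := ss.
  rewrite (valE t nu mu) // ?(valE u nu mu) // => v vtu; apply: ss.
    by move: vtu; rewrite !mem_term_vars !inE => ->; rewrite orbT.
  by move: vtu; rewrite !mem_term_vars !inE => ->.
- by rewrite (IHG nu mu).
- by rewrite (IHG nu mu) ?(IHH nu mu) // => v vG; apply: ss;
    rewrite mem_cat vG ?orbT.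
- by rewrite (IHG nu mu) ?(IHH nu mu) // => v vG; apply: ss;
    rewrite mem_cat vG ?orbT.
- by rewrite (IHG nu mu) ?(IHH nu mu) // => v vG; apply: ss;
    rewrite mem_cat vG ?orbT.
- have vs : v \in s by apply: ss; rewrite inE eqxx.
  have Gs : {subset fo_vars G <= s}.
    by move=> w wG; apply: ss; rewrite inE wG orbT.
  by split=> G_ c Ic; apply/(IHG _ _ Gs (updE nu mu v c vs numu))/G_.
- have vs : v \in s by apply: ss; rewrite inE eqxx.
  have Gs : {subset fo_vars G <= s}.
    by move=> w wG; apply: ss; rewrite inE wG orbT.
  by split=> -[c [Ic Gc]]; exists c; split => //;
    apply/(IHG _ _ Gs (updE nu mu v c vs numu)).
Qed.

(** The left inverse [g] turns an assignment on [V] into one on [W]. *)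
Lemma models_relabel (I : instance const) (s : seq V) (F : fo const V) g :
    {subset fo_vars F <= s} -> {in s, cancel f g} ->
  models I (relabel_fo F) <-> models I F.
Proof.
move=> Fs fK; have finj := can_in_inj fK; split=> [FI mu|FI nu].
  apply/(sat_relabel I Fs finj (nu := mu \o g)) => // v vs /=.
  by rewrite fK.
by apply/(sat_relabel I Fs finj (mu := nu \o f)).
Qed.

Definition relabel_dtgd (d : dtgd V) : dtgd W :=
  Dtgd (map f (dtgd_xs d)) (map f (dtgd_ys d)) (map (map_atom f) (dtgd_body d))
    [seq (map f p.1, map (map_atom f) p.2) | p <- dtgd_heads d].

Lemma relabel_dtgdE (d : dtgd V) :
  dtgd_fo const (relabel_dtgd d) = relabel_fo (dtgd_fo const d).
Proof.
have conjE (s : seq (atom V)) :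
    conj_var_atoms const (map (map_atom f) s) =
    relabel_fo (conj_var_atoms const s).
  rewrite /conj_var_atoms /conj_atoms; elim: s => //= a s ->.
  by rewrite !map_atom_comp.
rewrite /dtgd_fo /= -map_cat; elim: (_ ++ _) => [|v vs /= -> //] /=.
rewrite conjE; congr FImp; elim: (dtgd_heads d) => [//|p ps /= ->]; congr FOr.
by elim: p.1 => [|v vs /= -> //] /=; rewrite conjE.
Qed.

End Relabel.

(** * Countably many codes for finite sets of DTGDs *)

(** A plain product, so that it inherits equality, choice and countability from its components. *)
Definition raw_dtgd (V : Type) : Type :=
  (seq V * seq V * seq (atom V) * seq (seq V * seq (atom V)))%type.

Definition dtgd_of_raw (V : choiceType) (t : raw_dtgd V) : dtgd V :=
  Dtgd t.1.1.1 t.1.1.2 t.1.2 t.2.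

Definition raw_of_dtgd (V : choiceType) (d : dtgd V) : raw_dtgd V :=
  (dtgd_xs d, dtgd_ys d, dtgd_body d, dtgd_heads d).

Lemma raw_of_dtgdK (V : choiceType) : cancel (@raw_of_dtgd V) (@dtgd_of_raw V).
Proof. by case. Qed.

(* A finite schema with finitely many DTGDs; the variables are natural numbers
   so that there are countably many codes even when [var] is uncountable. *)
Definition code : Type := (seq relsym * seq (raw_dtgd nat))%type.

HB.instance Definition _ := Countable.on code.

Section Codes.
Variables const var : choiceType.

(** No database appears because the data schema will be empty. *)
Definition code_entails (p : code) (q : bcq const var) : Prop :=
  forall I : instance const, Defs.over [set` p.1] I ->
    {in p.2, forall t, models I (dtgd_fo const (dtgd_of_raw t))} ->
    models I (bcq_fo q).

(* Facts over symbols outside [s] matter only through the constants they put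
   into the active domain, and one symbol of positive arity can do that. *)
Lemma restrict_schema (R : set relsym) (s : seq relsym) :
    {in s, forall r, R r} ->
  exists s' : seq relsym, {in s', forall r, R r} /\
    forall I : instance const, Defs.over R I ->
    exists J : instance const, [/\ Defs.over [set` s'] J, adom I = adom J &
      forall a, arel a \in s -> I a <-> J a].
Proof.
move=> sR; have [[r0 [Rr0 r0s r0_gt0]]|no] :=
  pselect (exists r, [/\ R r, r \notin s & 0 < arity r]).
- exists (r0 :: s); split=> [r|I IR].
    by rewrite inE => /predU1P[->//|/sR].
  pose diag (c : const) : fact const :=
    existT (fun r => (arity r).-tuple const) r0 [tuple of nseq (arity r0) c].
  (* The diagonal facts over [r0] restore the whole active domain; as [r0] is not in [s], they do
     not disturb the facts over [s]. *)
  exists [set a | I a /\ arel a \in s \/ exists2 c, adom I c & a = diag c].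
  split.
  + move=> a [[_ ra]|[c _ ->]] /=; first by rewrite inE ra orbT.
    by rewrite inE eqxx.
  + apply/seteqP; split=> c.
      move=> Ic; exists (diag c); split; first by right; exists c.
      by rewrite /aargs /= mem_nseq r0_gt0 eqxx.
    move=> [a [[[Ia _]|[d Id ->]] ca]]; first by exists a.
    by move: ca; rewrite /aargs /= mem_nseq => /andP[_ /eqP->].
  + move=> a ra; split=> [Ia|]; first by left.
    by case=> [[]//|[c _ ac]]; rewrite ac in ra; rewrite ra in r0s.
(* Here every symbol of [R] outside [s] is nullary, so dropping its facts loses no constant. *)
- exists s; split=> // I IR; exists [set a | I a /\ arel a \in s].
  split=> [a []//||a ra]; last by split=> [|[]].
  apply/seteqP; split=> c [a]; last by move=> [[Ia _] ca]; exists a.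
  move=> [Ia ca]; exists a; split=> //; split=> //.
  apply: contrapT => /negP ra; apply: no; exists (arel a); split=> //.
    exact: IR.
  have <- : size (aargs a) = arity (arel a) by exact: size_tuple.
  by case: (aargs a) ca.
Qed.

(** An instance over the finite schema is one over [R]; conversely, an instance over [R] is cut down
    by [restrict_schema] without affecting the DTGDs or the query. Variables are coded by their
    positions in a list of all variables that occur. *)
Lemma entails_code (v0 : var) (R Q : set relsym) (Sigma : set (dtgd var)) :
    finite_set Q -> Q `<=` R -> finite_set Sigma -> Sigma `<=` is_dtgd R ->
  exists p : code, forall q : bcq const var, is_bcq Q q ->
    (entails R set0 Sigma q <-> code_entails p q).
Proof.
move=> /finite_seqP[sQ ->] QR finS SR.
have [ds dsE] : exists ds : seq (raw_dtgd var),
    forall d, Sigma d <-> exists2 t, t \in ds & d = dtgd_of_raw t.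
  have /finite_seqP[ds dsE] := finite_image (@raw_of_dtgd var) finS.
  exists ds => d; split=> [Sd|[t tds ->]].
    exists (raw_of_dtgd d); last by rewrite raw_of_dtgdK.
    by have : [set` ds] (raw_of_dtgd d) by rewrite -dsE; exists d.
  have [d' Sd' <-] : (@raw_of_dtgd var @` Sigma) t by rewrite dsE.
  by rewrite raw_of_dtgdK.
pose F t := dtgd_fo const (dtgd_of_raw (t : raw_dtgd var)).
pose vs := flatten [seq fo_vars (F t) | t <- ds].
(* Including all of [Q] makes one code serve every query over [Q]. *)
pose rs := sQ ++ flatten [seq fo_rels (F t) | t <- ds].
have F_vs t : t \in ds -> {subset fo_vars (F t) <= vs}.
  move=> tds v vF; apply/flattenP.
  by exists (fo_vars (F t)) => //; apply: map_f.
have F_rs t r : t \in ds -> r \in fo_rels (F t) -> r \in rs.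
  move=> tds rF; rewrite mem_cat; apply/orP; right; apply/flattenP.
  by exists (fo_rels (F t)) => //; apply: map_f.
have rsR : {in rs, forall r, R r}.
  move=> r; rewrite mem_cat => /orP[/QR//|/flattenP[_ /mapP[t tds ->]]].
  apply: ((fo_over_rels R (F t)).1 _ r).
  by apply/fo_over_dtgd/SR/dsE; exists t.
have [L [LR restr]] := restrict_schema rsR.
have gK : {in vs, cancel (index^~ vs) (nth v0 vs)}.
  by move=> v vvs; rewrite /= nth_index.
pose cs :=
  [seq raw_of_dtgd (relabel_dtgd (index^~ vs) (dtgd_of_raw t)) | t <- ds].
exists (L, cs).
have codeE I :
    {in cs, forall t, models I (dtgd_fo const (dtgd_of_raw t))} <->
    forall d, Sigma d -> models I (dtgd_fo const d).
  split=> [mI d /dsE[t tds ->]|mI _ /mapP[t tds ->]].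
    apply/(models_relabel I (F_vs t tds) gK); rewrite -relabel_dtgdE.
    by rewrite -[relabel_dtgd _ _]raw_of_dtgdK; apply: mI; apply: map_f.
  rewrite raw_of_dtgdK relabel_dtgdE; apply/(models_relabel I (F_vs t tds) gK).
  by apply: mI; apply/dsE; exists t.
move=> q [_ qQ]; split=> [Sq I IL /codeE mI|pq I IR _ mI].
  by apply: Sq => // a /IL/LR.
have [J [JL IJ aIJ]] := restr I IR.
have q_rs r : r \in fo_rels (bcq_fo q) -> r \in rs.
  by rewrite fo_rels_bcq => /mapP[a /qQ aQ ->]; rewrite mem_cat aQ.
apply/(models_local IJ (fun a ra => aIJ a (q_rs _ ra))).
apply: pq => //; apply/codeE => d Sd.
apply/(@models_local _ _ I); [by [] | | exact: mI].
move=> a ra; apply: aIJ; have [t tds dE] := (dsE d).1 Sd.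
by apply: (F_rs t) => //; rewrite /F -dE.
Qed.

End Codes.

(** * Ontologies generated by a set of queries *)

Section QueryTheories.
Variables const var : choiceType.
Hypothesis const_infinite : infinite_set [set: const].

Definition query_theory (Q : set relsym) (A : set (bcq const var)) :
    set (instance const * bcq const var) :=
  [set p | is_pair set0 Q p /\
    forall I, (forall q, A q -> models I (bcq_fo q)) -> models I (bcq_fo p.2)].

(** Needed for closure under entailment, where the constants of the entailed query must lie in the
    database. The instance of all facts avoiding [c] falsifies [q'], but would satisfy [q] if [c]
    did not occur there. *)
Lemma bcq_entails_const (q q' : bcq const var) (c : const) :
  bcq_entails q q' -> bcq_const q' c -> bcq_const q c.
Proof.
move=> qq' [a' a'q' ca']; apply: contrapT => qc.
have [d dc] := infinite_other c const_infinite.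
(* All the variables of [q] can be sent to [d]. *)
pose I : instance const := [set a | c \notin aargs a].
have : models I (bcq_fo q).
  apply/(models_bcqP I q d); exists (fun=> d) => a aq.
  apply/mapP => -[[e|v] ea /= ce]; last by rewrite ce in dc.
  by apply: qc; exists a => //; rewrite ce.
move/qq'/(models_bcqP I q' d) => [mu /(_ _ a'q')].
by move/mapP; apply; exists (inl c).
Qed.

Lemma query_theory_ontology Q A : is_ontology set0 Q (query_theory Q A).
Proof.
have [c0] := infinite_inhabited const_infinite.
split=> [p []//|I q q' r [[/= dbI bq cq] Aq] [[/= _ bq' cq'] Aq']
  [f [finj ff' ->]]|I q q' bq' qq' [[/= dbI bq cq] Aq]
  |I J q [_ /over_set0 J0] _ [[/= [finI /over_set0 I0] bq cq] Aq]].
- split; first split=> //=.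
  + case: bq => q0 qQ; case: bq' => _ q'Q.
    split=> [|a]; first by case: (q) q0.
    by rewrite mem_cat => /orP[/qQ//|/mapP[a' a'q' ->]]; exact: (q'Q a').
  + move=> c [a]; rewrite mem_cat => /orP[aq ca|/mapP[a' a'q' ->]].
      by apply: cq; exists a.
    rewrite aargs_map => /mapP[[e|//] ea [ce]].
    by apply: cq'; exists a' => //; rewrite ce.
  move=> J AJ; have /(models_bcqP J q c0)[mu qmu] := Aq J AJ.
  have /(models_bcqP J q' c0)[mu' qmu'] := Aq' J AJ.
  (* The two assignments are glued: [mu] on the variables of [q], and [mu'] pulled back along [f] on
     the renamed variables of [q']. *)
  pose nu v := if v \in bcq_vars q then mu v else
    if pselect (exists w, f w = v) is left e then mu' (projT1 (cid e)) else c0.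
  apply/(models_bcqP J _ c0); exists nu => a.
  rewrite mem_cat => /orP[aq|/mapP[a' a'q' ->]].
    rewrite (@eq_map_atom _ _ _ (term_val mu)); first exact: qmu.
    by move=> [//|v] va; rewrite /= /nu (mem_bcq_vars aq va).
  rewrite map_atom_comp (@eq_map_atom _ _ _ (term_val mu')); first exact: qmu'.
  move=> [//|v] va; rewrite /= /nu.
  rewrite (negbTE (ff' v (mem_bcq_vars a'q' va))).
  case: pselect => [e|[]]; last by exists v.
  by case: cid => w /= /finj ->.
- split=> [|J AJ]; last exact/qq'/Aq.
  by split=> // c /(bcq_entails_const qq'); exact: cq.
(* Both databases are empty, so the arrow moves nothing. *)
- rewrite J0 -I0; split=> //=; split=> //=; split => //.
  by rewrite I0 => a.
Qed.

Lemma query_theory_rewritable Q A : fo_rewritable set0 Q (query_theory Q A).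
Proof.
have [c0] := infinite_inhabited const_infinite.
move=> q bq; have [qO|qO] := pselect (query_theory Q A (set0, q)).
  by exists (@FTrue _ _); split=> // I [_ /over_set0 ->].
exists (FNot (@FTrue _ _)); split=> // I [_ /over_set0 ->] _.
(* An assignment must exist, or else even a false sentence would hold vacuously. *)
by split=> // /(_ (fun=> c0)) /=.
Qed.

End QueryTheories.

(** * Independence of the path queries *)

Section PathQueries.

(** Symbols are pairs of a name and an arity, so start and edge share the name 0 but remain
    distinct. *)
Definition start_atom (X : Type) (x : X) : atom X :=
  existT (fun r => (arity r).-tuple X) (0, 1) [tuple x].
Definition edge_atom (X : Type) (x y : X) : atom X :=
  existT (fun r => (arity r).-tuple X) (0, 2) [tuple x; y].
Definition end_atom (X : Type) (x : X) : atom X :=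
  existT (fun r => (arity r).-tuple X) (1, 1) [tuple x].

Definition path_schema : set relsym := [set` [:: (0, 1); (0, 2); (1, 1)]].

Variables const var : choiceType.
Variable x : nat -> var.

Definition path_query (n : nat) : bcq const var :=
  [:: start_atom (inr (x 0)), end_atom (inr (x n))
    & [seq edge_atom (inr (x i)) (inr (x i.+1)) | i <- iota 0 n]].

Lemma path_query_is_bcq n : is_bcq path_schema (path_query n).
Proof.
split=> // a; rewrite !inE => /or3P[/eqP->|/eqP->|/mapP[i _ ->]];
  by rewrite /path_schema /= !inE eqxx ?orbT.
Qed.

Lemma path_query_const n : bcq_const (path_query n) = set0.
Proof.
apply/seteqP; split=> // c [a].
by rewrite !inE => /or3P[/eqP->|/eqP->|/mapP[i _ ->]]; rewrite /aargs /= !inE.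
Qed.

(* [g (m, i)] is the i-th node of the m-th path; harmless superfluous edges
   continue the m-th path beyond its end [g (m, m)]. *)
Definition path_instance (g : nat * nat -> const) (S : set nat) :
    instance const :=
  [set a | exists2 m, S m & [\/ a = start_atom (g (m, 0)),
    exists i, a = edge_atom (g (m, i)) (g (m, i.+1)) | a = end_atom (g (m, m))]].

(** The start atom selects a path [m]. By injectivity of [g] the edges then force the i-th variable
    onto [g (m, i)], and the end atom forces [n = m]. *)
Lemma path_instanceP g S n (c0 : const) :
    injective g -> injective x ->
  models (path_instance g S) (bcq_fo (path_query n)) <-> S n.
Proof.
move=> ginj xinj; split=> [/(models_bcqP _ _ c0)[mu qmu]|Sn].
(* Comparing symbols and argument lists separately avoids equalities between dependent pairs. *)
- have argsE a b : a = b -> arel a = arel b /\ aargs a = aargs b :> seq const.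
    by move=> ->.
  have [m mu0] : exists m, mu (x 0) = g (m, 0).
    have [|m Sm] := qmu (start_atom (inr (x 0))); first by rewrite inE eqxx.
    case=> [/argsE[_ [->]]|[i /argsE[]//]|/argsE[]//]; by exists m.
  have mui i : i <= n -> mu (x i) = g (m, i).
    elim: i => [//|i IHi] lt_in.
    have [|m' Sm'] := qmu (edge_atom (inr (x i)) (inr (x i.+1))).
      rewrite !inE; apply/or3P; apply: Or33; apply/mapP; exists i => //.
      by rewrite mem_iota.
    case=> [/argsE[]//|[j /argsE[_ [+ ->]]]|/argsE[]//].
    by rewrite IHi ?(ltnW lt_in) // => /ginj[-> ->].
  have [|m' Sm'] := qmu (end_atom (inr (x n))); first by rewrite !inE eqxx orbT.
  case=> [/argsE[]//|[j /argsE[]//]|/argsE[_ [+]]].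
  by rewrite mui // => /ginj[_ ->].
(* The i-th variable goes to the i-th node of path [n], by inverting [x]. *)
- pose mu v := if pselect (exists i, x i = v) is left e
    then g (n, projT1 (cid e)) else c0.
  have muE i : mu (x i) = g (n, i).
    rewrite /mu; case: pselect => [e|[]]; last by exists i.
    by case: cid => j /= /xinj ->.
  apply/(models_bcqP _ _ c0); exists mu => a.
  rewrite !inE => /or3P[/eqP->|/eqP->|/mapP[i _ ->]]; exists n => //.
  + by apply: Or31; rewrite -muE; congr existT; apply: val_inj.
  + by apply: Or33; rewrite -muE; congr existT; apply: val_inj.
  + by apply: Or32; exists i; rewrite -!muE; congr existT; apply: val_inj.
Qed.

End PathQueries.

(** * Diagonalization over all codes *)

Theorem proposition9 (const var : choiceType)
    (const_infinite : infinite_set [set: const])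
    (var_infinite : infinite_set [set: var]) :
  exists (D Q : set relsym) (O : set (instance const * bcq const var)),
    [/\ finite_set D, finite_set Q, is_ontology D Q O, fo_rewritable D Q O &
      ~ exists (R : set relsym) (Sigma : set (dtgd var)),
          [/\ D `|` Q `<=` R, finite_set Sigma, Sigma `<=` is_dtgd R &
              O = Sem R Sigma D Q]].
Proof.
have [c0] := infinite_inhabited const_infinite.
have [x xinj] := infinite_injection var_infinite.
have [k kinj] := infinite_injection const_infinite.
pose q n : bcq const var := path_query const x n.
(* The diagonal set: [n] is left out exactly when it codes some [p] that entails the path query of
   length [n]. *)
pose S : set nat :=
  [set n | forall p : code, unpickle n = Some p -> ~ code_entails p (q n)].
pose A := q @` S.
have finQ : finite_set path_schema by exact: finite_seq.
have qpair n : is_pair set0 path_schema (set0 : instance const, q n).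
  split=> /=; [by split | exact: path_query_is_bcq |].
  by rewrite path_query_const.
(* The instance whose paths have exactly the lengths in [S] satisfies all of [A], so closing [A]
   under consequence adds no further path query. *)
have AS n : query_theory path_schema A (set0, q n) <-> S n.
  split=> [[_ /= qn]|Sn]; last by split=> //= I; apply; exists n.
  have ginj : injective (k \o @pickle (nat * nat)%type).
    by apply: inj_comp => //; exact: pcan_inj pickleK.
  apply/(path_instanceP S n c0 ginj xinj)/qn => _ [m Sm <-].
  exact/(path_instanceP S m c0 ginj xinj).
exists set0, path_schema, (query_theory path_schema A); split=> //.
- exact: query_theory_ontology.
- exact: query_theory_rewritable.
case=> R [Sigma [QR finS SR OE]].
have {}QR : path_schema `<=` R by move=> r Qr; apply: QR; right.
have [p pE] := entails_code const (x 0) finQ QR finS SR.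
(* At the number of its own code, the supposed definition entails the query if and only if it does
   not. *)
pose n := pickle p.
have := AS n; rewrite OE => SemS.
have nS : S n <-> code_entails p (q n).
  rewrite -SemS -pE; last exact: path_query_is_bcq.
  by split=> [[]|].
have Sn : S n <-> ~ code_entails p (q n).
  by split=> [/(_ p (pickleK p))//|np p']; rewrite pickleK => -[<-].
by move: nS; rewrite Sn; tauto.
Qed.
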